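(* There exists a constant $c$ such that for every positive integer $k$ and every $k$-regular graph $G$, $$\chi_d(G)\leq \chi(G)+c\ln k+1.$$
   Context: All graphs are finite and simple. A dynamic coloring of a graph $G$ is a proper vertex coloring such that every vertex of degree at least $2$ has neighbors of at least two different colors. The dynamic chromatic number $\chi_d(G)$ is the smallest number of colors in a dynamic coloring of $G$; $\chi(G)$ is the usual chromatic number. *)

(* Defs.v *)
From mathcomp Require Import all_boot.

Set Implicit Arguments.
Unset Strict Implicit.
Unset Printing Implicit Defensive.

Record sgraph := SGraph {
  vertex :> finType;
  adj : rel vertex;
  adj_sym : symmetric adj;
  adj_irr : irreflexive adj
}.

Definition neighbors (G : sgraph) (x : G) : {set G} := [set y | adj x y].

Definition degree (G : sgraph) (x : G) : nat := #|neighbors x|.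

Definition regular (k : nat) (G : sgraph) : Prop := forall x : G, degree x = k.

Definition proper_coloring (G : sgraph) (C : finType) (f : {ffun G -> C}) : bool :=
  [forall x, forall y, adj x y ==> (f x != f y)].

Definition dynamic_coloring (G : sgraph) (C : finType) (f : {ffun G -> C}) : bool :=
  proper_coloring f &&
  [forall x, (2 <= degree x) ==> (2 <= #|f @: neighbors x|)].

Definition colorable (G : sgraph) (n : nat) : bool :=
  [exists f : {ffun G -> 'I_n}, proper_coloring f].

Definition dyn_colorable (G : sgraph) (n : nat) : bool :=
  [exists f : {ffun G -> 'I_n}, dynamic_coloring f].

(* Giving every vertex its own color is a dynamic coloring, so the minima
   defining both chromatic numbers exist. *)
Lemma ex_dyn_colorable (G : sgraph) : exists n, dyn_colorable G n.
Proof.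
exists #|G|; apply/existsP; exists [ffun x => enum_rank x].
apply/andP; split.
  apply/forallP=> x; apply/forallP=> y; apply/implyP=> xy; rewrite !ffunE.
  by apply: contraTneq xy => /enum_rank_inj->; rewrite adj_irr.
apply/forallP=> x; apply/implyP=> dx; rewrite card_imset // => y z.
by rewrite !ffunE => /enum_rank_inj.
Qed.

Lemma ex_colorable (G : sgraph) : exists n, colorable G n.
Proof.
have [n /existsP[f /andP[fP _]]] := ex_dyn_colorable G.
by exists n; apply/existsP; exists f.
Qed.

Definition chi (G : sgraph) : nat := ex_minn (ex_colorable G).

Definition chi_d (G : sgraph) : nat := ex_minn (ex_dyn_colorable G).

(* Main.v *)
(* For large k, put every vertex into a set T independently with probability
   about 5 log2(k) / k.  By the symmetric local lemma (the neighborhoods of x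
   and y interact only if they meet, so each event depends on at most k^2
   others) T can be chosen so that every neighborhood meets T in at least one
   and in fewer than m = O(log k) vertices, where m <= k.  Keep an optimal proper
   coloring outside T and color T greedily with m new colors: every
   neighborhood then contains both an old and a new color.  For bounded k > 1,
   greedily coloring the square of G costs only a constant, which is absorbed
   by c ln k; for k = 1 every proper coloring is dynamic. *)
Require Import Defs.
From mathcomp Require Import all_boot all_order all_algebra.
From mathcomp Require Import reals exp.
From mathcomp Require Import zify.

Set Implicit Arguments.
Unset Strict Implicit.
Unset Printing Implicit Defensive.

Import Order.TTheory GRing.Theory Num.Theory.

(** * Union bound and symmetric local lemma, by counting *)

Lemma leq_card_bigcup (I T : finType) (P : pred I) (F : I -> {set T}) :
  #|\bigcup_(i | P i) F i| <= \sum_(i | P i) #|F i|.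
Proof.
elim/big_rec2: _ => [|i n A _ le_An]; first by rewrite cards0.
by apply: leq_trans (leq_card_setU _ _) _; rewrite leq_add2l.
Qed.

(** Probability is uniform on [{ffun T -> C}] and expressed by cardinalities, so events over
    disjoint coordinate sets are independent. *)
Definition determined_by (T C : finType) (D : {set T}) (A : {set {ffun T -> C}}) :=
  forall f g : {ffun T -> C}, {in D, f =1 g} -> (f \in A) = (g \in A).

(* Exchanging the [D]-parts of two assignments is an involution of the pairs
   which turns [(A :&: B) x setT] into [A x B]. *)
Lemma card_setI_indep (T C : finType) (D : {set T}) (A B : {set {ffun T -> C}}) :
  determined_by D A -> determined_by (~: D) B ->
  #|A :&: B| * #|{ffun T -> C}| = #|A| * #|B|.
Proof.
move=> dA dB; pose mix (f g : {ffun T -> C}) := [ffun x => if x \in D then f x else g x].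
pose swap (p : {ffun T -> C} * {ffun T -> C}) := (mix p.1 p.2, mix p.2 p.1).
have swapK : involutive swap.
  by case=> f g; congr pair; apply/ffunP=> x; rewrite !ffunE /=; case: (x \in D).
rewrite -[#|{ffun _}|]cardsT -!cardsX -[RHS](card_imset _ (inv_inj swapK)).
apply: eq_card => -[f g]; rewrite -[in RHS](swapK (f, g)) mem_imset; last exact: inv_inj.
rewrite !inE /= andbT; congr (_ && _).
  by apply: dA => x xD; rewrite ffunE xD.
by apply: dB => x; rewrite inE => /negbTE xD; rewrite ffunE xD.
Qed.

Section LocalLemma.

Variables (T C I : finType) (D : I -> {set T}) (A : I -> {set {ffun T -> C}}) (d : nat).
Hypothesis dA : forall i, determined_by (D i) (A i).
Hypothesis card_dep : forall i, #|[set j | ~~ [disjoint D j & D i]]| <= d.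
Hypothesis card_bad : forall i, 4 * d * #|A i| <= #|{ffun T -> C}|.

Let good (S : {set I}) := [set f | [forall i in S, f \notin A i]].

Let goodP (S : {set I}) f : reflect (forall i, i \in S -> f \notin A i) (f \in good S).
Proof. by rewrite inE; apply: forall_inP. Qed.

(* The conditional form of the local lemma: given that no event of [S] occurs,
   the event [i] has probability at most 1/(2d). *)
Lemma local_lemma_step (S : {set I}) i :
  0 < #|{ffun T -> C}| -> 2 * d * #|A i :&: good S| <= #|good S|.
Proof.
move=> Omega_gt0; have [n] := ubnP #|S|; elim: n => // n IHn in S i *.
rewrite ltnS => leSn.
(* [S1] collects the events of [S] that may depend on [A i]; avoiding all of [S2] is independent of
   [A i]. *)
set S1 := S :&: [set j | ~~ [disjoint D j & D i]].
set S2 := S :\: [set j | ~~ [disjoint D j & D i]].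
have S1d : #|S1| <= d by apply: leq_trans (card_dep i); exact: subset_leq_card (subsetIr _ _).
have sgood : good S \subset good S2.
  by apply/subsetP=> f /goodP fS; apply/goodP => j; rewrite inE => /andP[_]; exact: fS.
have indep : #|A i :&: good S2| * #|{ffun T -> C}| = #|A i| * #|good S2|.
  apply: card_setI_indep (@dA i) _ => f g fg.
  suff eqA j : j \in S2 -> (f \in A j) = (g \in A j).
    by apply/goodP/goodP => H j jS; [rewrite -eqA|rewrite eqA] => //; apply: H.
  rewrite !inE negbK => /andP[/pred0P dj _]; apply: dA => x xD; apply: fg.
  by rewrite inE; have /= := dj x; rewrite xD /= => ->.
(* Given [good S2], each event of [S1] has probability at most 1/(2d) by induction, so the union
   bound loses at most half. If [S1] is empty, then [S2] is [S] and the induction hypothesis does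
   not apply. *)
have le2 : #|good S2| <= 2 * #|good S|.
  have [S10|[j jS1]] := set_0Vmem S1.
    suff -> : S2 = S by rewrite leq_pmull.
    by apply/setDidPl; rewrite -setI_eq0 -/S1 S10.
  have ltS2 : #|S2| < n.
    apply: leq_trans leSn; rewrite -(cardsID [set j | ~~ [disjoint D j & D i]] S).
    by rewrite -[X in X < _]add0n ltn_add2r card_gt0; apply/set0Pn; exists j.
  have d_gt0 : 0 < d by apply: leq_trans S1d; apply/card_gt0P; exists j.
  have cover : #|good S2| <= #|good S| + \sum_(u in S1) #|A u :&: good S2|.
    apply: leq_trans (leq_add (leqnn _) (leq_card_bigcup _ _)).
    apply: leq_trans (leq_card_setU _ _); apply/subset_leq_card/subsetP=> f fS2.
    rewrite inE; have [//|fS] := boolP (f \in good S).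
    apply/bigcupP; move: fS; rewrite inE => /forall_inPn[u uS]; rewrite negbK => fu.
    exists u; last by rewrite inE fu.
    rewrite inE uS; apply: contraT => udep; have /goodP/(_ u) := fS2.
    by rewrite fu inE udep uS => /(_ isT).
  have small : 2 * d * (\sum_(u in S1) #|A u :&: good S2|) <= d * #|good S2|.
    rewrite big_distrr /=; apply: leq_trans (_ : \sum_(u in S1) #|good S2| <= _).
      by apply: leq_sum => u _; apply: IHn.
    by rewrite sum_nat_const leq_mul2r S1d orbT.
  rewrite -(leq_pmul2l d_gt0); nia.
have : 4 * d * #|A i :&: good S2| <= #|good S2|.
  rewrite -(leq_pmul2r Omega_gt0) -mulnA indep mulnA mulnC leq_mul2l.
  by rewrite card_bad orbT.
have : #|A i :&: good S| <= #|A i :&: good S2| by apply: subset_leq_card; apply: setIS.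
nia.
Qed.

(** Adding one event at a time loses at most a fraction 1/(2d) of the surviving assignments, so some
    always survive. *)
Lemma local_lemma : 0 < d -> 0 < #|{ffun T -> C}| -> exists f, forall i, f \notin A i.
Proof.
move=> d_gt0 Omega_gt0.
suff good_gt0 (S : {set I}) : 0 < #|good S|.
  have /card_gt0P[f /goodP fP] := good_gt0 setT.
  by exists f => i; apply: fP.
have [n] := ubnP #|S|; elim: n => // n IHn in S *; rewrite ltnS => leSn.
have [->|[i iS]] := set_0Vmem S.
  have [f _] := card_gt0P Omega_gt0.
  by apply/card_gt0P; exists f; apply/goodP => i; rewrite inE.
have IH : 0 < #|good (S :\ i)| by apply: IHn; rewrite (cardsD1 i) iS in leSn.
have := local_lemma_step (S :\ i) i Omega_gt0.
have : #|good (S :\ i)| <= #|A i :&: good (S :\ i)| + #|good S|.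
  apply: leq_trans (leq_card_setU _ _); apply/subset_leq_card/subsetP=> f /goodP fS.
  rewrite !inE; have [fA|fA] /= := boolP (f \in A i).
    by apply/orP; left; apply/forall_inP => j; exact: fS.
  apply/forall_inP => j jS; have [->//|ji] := eqVneq j i.
  by apply: fS; rewrite !inE ji.
nia.
Qed.

End LocalLemma.

(** * Sparse hitting sets in regular graphs *)

(** Coordinates are independent, so the probability is [(#|P| / #|C|) ^ #|D|]; denominators are
    cleared. *)
Lemma card_cylinder (T C : finType) (D : {set T}) (P : pred C) :
  #|[set f : {ffun T -> C} | [forall x in D, P (f x)]]| * #|C| ^ #|D|
  = #|P| ^ #|D| * #|{ffun T -> C}|.
Proof.
pose F x : pred C := if x \in D then P else predT.
have -> : #|[set f : {ffun T -> C} | [forall x in D, P (f x)]]| = #|family F|.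
  apply: eq_card => f; rewrite inE; apply/forall_inP/familyP => H x.
    by rewrite /F; case: ifP => // xD; apply: H.
  by move=> xD; have := H x; rewrite /F xD.
rewrite card_family foldrE big_map big_enum /= (bigID (mem D)) /=.
rewrite (eq_bigr (fun=> #|P|)) => [|x xD]; last by rewrite /F xD.
rewrite [X in _ * X * _](eq_bigr (fun=> #|C|)) => [|x xD]; last by rewrite /F (negbTE xD).
rewrite !prod_nat_const card_ffun -mulnA -expnD; congr (_ * _ ^ _).
by rewrite addnC -cardsT -(cardsID D setT) setTI; congr (_ + _); apply: eq_card => x;
  rewrite !inE andbT.
Qed.

(* [T] is the zero set of a random [f : G -> 'I_q.+1]; the two numerical
   hypotheses bound the probabilities of missing [T] and of meeting it at least
   [m] times by 1/(8 k^2) each. *)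
Lemma sparse_hitting_set (G : sgraph) k q m :
  0 < k -> regular k G ->
  8 * k ^ 2 * q ^ k <= q.+1 ^ k -> 8 * k ^ 2 * 'C(k, m) <= q.+1 ^ m ->
  exists T : {set G}, forall x : G, 0 < #|neighbors x :&: T| < m.
Proof.
move=> k_gt0 Gk none many.
pose Z (f : {ffun G -> 'I_q.+1}) := [set x | f x == ord0].
pose A (x : G) := [set f | ~~ (0 < #|neighbors x :&: Z f| < m)].
have dA x : determined_by (neighbors x) (A x).
  move=> f g fg; rewrite !inE.
  suff -> : neighbors x :&: Z f = neighbors x :&: Z g by [].
  by apply/setP=> y; rewrite !inE; have [xy|] := boolP (adj x y); rewrite //= fg ?inE.
have dep (x : G) : #|[set y : G | ~~ [disjoint neighbors y & neighbors x]]| <= k ^ 2.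
  apply: leq_trans (_ : #|\bigcup_(z in neighbors x) neighbors z| <= _).
    apply/subset_leq_card/subsetP=> y; rewrite inE => /pred0Pn[z /= /andP[yz xz]].
    by rewrite inE adj_sym in yz; apply/bigcupP; exists z; rewrite // inE.
  apply: leq_trans (leq_card_bigcup _ _) _.
  rewrite (eq_bigr (fun=> k)) => [|z _]; last exact: Gk.
  by rewrite sum_nat_const -[#|_|]/(degree x) Gk.
have bad x : 4 * k ^ 2 * #|A x| <= #|{ffun G -> 'I_q.+1}|.
  (* [B]: the neighborhood misses the zero set. [U]: some [m]-subset of it consists of zeros, a
     union bound over ['C(k, m)] cylinders. *)
  pose B := [set f : {ffun G -> 'I_q.+1} | [forall y in neighbors x, f y != ord0]].
  pose E (S : {set G}) := [set f : {ffun G -> 'I_q.+1} | [forall y in S, f y == ord0]].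
  pose U := \bigcup_(S in [set S : {set G} | S \subset neighbors x & #|S| == m]) E S.
  have sA : A x \subset B :|: U.
    apply/subsetP=> f; rewrite !inE negb_and -eqn0Ngt -leqNgt.
    case/orP=> [/eqP/cards0_eq fx0|].
      apply/orP; left; apply/forall_inP=> y xy; apply/negP=> fy.
      by have /setP/(_ y) := fx0; rewrite inE xy !inE fy.
    case/card_geqP=> s [us sz ss]; apply/orP; right; apply/bigcupP.
    exists [set y in s].
      rewrite inE; apply/andP; split; last by rewrite cardsE (card_uniqP us) sz.
      by apply/subsetP=> y; rewrite inE => /ss /setIP[].
    by rewrite inE; apply/forall_inP=> y; rewrite inE => /ss /setIP[_]; rewrite inE.
  set N := #|{ffun G -> 'I_q.+1}|.
  have leB : 8 * k ^ 2 * #|B| <= N.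
    have := card_cylinder (neighbors x) (predC1 (ord0 : 'I_q.+1)).
    rewrite -/B -[#|neighbors x|]/(degree x) Gk cardC1 card_ord /= -/N => eqB.
    rewrite -(leq_pmul2r (_ : 0 < q.+1 ^ k)) ?expn_gt0 // -mulnA eqB mulnA [N * _]mulnC.
    by rewrite leq_mul2r none orbT.
  have leU : 8 * k ^ 2 * #|U| <= N.
    have leUC : #|U| * q.+1 ^ m <= 'C(k, m) * N.
      apply: leq_trans (leq_mul (leq_card_bigcup _ _) (leqnn _)) _.
      rewrite big_distrl /= (eq_bigr (fun=> N)) => [|S].
        by rewrite sum_nat_const cards_draws -[#|neighbors x|]/(degree x) Gk.
      rewrite inE => /andP[_ /eqP <-].
      by have := card_cylinder S (pred1 (ord0 : 'I_q.+1)); rewrite card1 exp1n mul1n card_ord.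
    rewrite -(leq_pmul2r (_ : 0 < q.+1 ^ m)) ?expn_gt0 // -mulnA.
    apply: leq_trans (leq_mul (leqnn _) leUC) _.
    by rewrite mulnA [N * _]mulnC leq_mul2r many orbT.
  have := leq_trans (subset_leq_card sA) (leq_card_setU _ _); nia.
have [||f fA] := local_lemma dA dep bad; rewrite ?expn_gt0 ?k_gt0 //.
  by rewrite card_ffun card_ord expn_gt0.
by exists (Z f) => x; have := fA x; rewrite inE negbK.
Qed.

(** * Greedy coloring and upper bounds for [chi_d] *)

Lemma greedy_coloring (T : finType) (e : rel T) d :
  symmetric e -> irreflexive e -> (forall x, #|[set y | e x y]| <= d) ->
  exists f : T -> 'I_d.+1, forall x y, e x y -> f x != f y.
Proof.
move=> esym eirr ed.
suff [f fP] : exists f : T -> 'I_d.+1,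
    {in enum T &, forall x y, e x y -> f x != f y}.
  by exists f => x y; apply: fP; rewrite mem_enum.
elim: (enum T) => [|a s [f fP]]; first by exists (fun=> ord0).
have [as_|as_] := boolP (a \in s).
  by exists f => x y; rewrite !inE => /predU1P[->|xs] /predU1P[->|ys]; apply: fP.
(* [c] avoids the values at all neighbors of [a], even those outside [s]; these still block at most
   [d] of the [d.+1] colors. *)
have [c cP] : exists c, c \notin f @: [set y | e a y].
  apply/existsP; rewrite -negb_forall; apply/negP=> /forallP all_c.
  have : #|'I_d.+1| <= #|f @: [set y | e a y]|.
    by apply/subset_leq_card/subsetP=> c _; apply: all_c.
  by rewrite card_ord leqNgt ltnS (leq_trans (leq_imset_card _ _)).
have cN y : e a y -> c != f y.
  by move=> ay; apply: contraNneq cP => ->; apply: imset_f; rewrite inE.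
exists (fun x => if x == a then c else f x) => x y; rewrite !inE.
case: eqVneq => [-> _|xa /= xs]; case: eqVneq => [-> _|ya /= ys].
- by rewrite eirr.
- exact: cN.
- by rewrite esym eq_sym; apply: cN.
- exact: fP.
Qed.

(** Allowing any finite palette lets old and new colors live in a sum type. *)
Lemma chi_d_le_card (G : sgraph) (C : finType) (f : G -> C) :
  (forall x y, adj x y -> f x != f y) ->
  (forall x : G, 2 <= degree x ->
     exists y z, [/\ adj x y, adj x z & f y != f z]) ->
  chi_d G <= #|C|.
Proof.
move=> fadj fdyn; rewrite /chi_d; case: ex_minnP => n _; apply.
apply/existsP; exists [ffun x => enum_rank (f x)]; apply/andP; split.
  apply/forallP=> x; apply/forallP=> y; apply/implyP=> xy.
  by rewrite !ffunE (inj_eq enum_rank_inj) fadj.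
apply/forallP=> x; apply/implyP=> /fdyn[y [z [xy xz fyz]]].
apply/card_gt1P; exists (enum_rank (f y)), (enum_rank (f z)).
split; last by rewrite (inj_eq enum_rank_inj).
  by apply/imsetP; exists y; rewrite ?inE ?ffunE.
by apply/imsetP; exists z; rewrite ?inE ?ffunE.
Qed.

Lemma chi_proper (G : sgraph) :
  exists f : G -> 'I_(chi G), forall x y, adj x y -> f x != f y.
Proof.
rewrite /chi; case: ex_minnP => n /existsP[f /forallP fP] _.
by exists f => x y xy; have /forallP/(_ y)/implyP := fP x; apply.
Qed.

(** The graph induced on [T] has degrees at most [m], so [m.+1] new colors suffice there. Each
    neighborhood meets [T] but is too large to lie inside it, so it sees both palettes. *)
Lemma chi_d_le_chi_sparse (G : sgraph) (T : {set G}) m :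
  (forall x : G, 0 < #|neighbors x :&: T| <= m) ->
  (forall x : G, m < degree x) ->
  chi_d G <= chi G + m.+1.
Proof.
move=> hit deg.
pose e := [rel x y : G | [&& adj x y, x \in T & y \in T]].
have [|||g gP] := @greedy_coloring G e m.
- by move=> x y /=; rewrite adj_sym [(x \in T) && _]andbC.
- by move=> x; rewrite /= adj_irr.
- move=> x; have /andP[_] := hit x; apply: leq_trans.
  by apply/subset_leq_card/subsetP=> y; rewrite !inE => /and3P[-> _ ->].
have [f fP] := chi_proper G.
pose h x : 'I_(chi G) + 'I_m.+1 := if x \in T then inr (g x) else inl (f x).
have -> : chi G + m.+1 = #|{: 'I_(chi G) + 'I_m.+1}| by rewrite card_sum !card_ord.
apply: (@chi_d_le_card _ _ h) => [x y xy|x _]; rewrite /h.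
  case: ifP => xT; case: ifP => yT //.
    by apply: contraTneq (gP x y _) => [[->]|]; rewrite ?eqxx //= xy xT yT.
  by apply: contraTneq (fP x y xy) => -[->]; rewrite eqxx.
have /andP[/card_gt0P[y] ] := hit x; rewrite !inE => /andP[xy yT] lt_m.
have /subsetPn[z xz zT] : ~~ (neighbors x \subset T).
  apply: contraL lt_m => /setIidPl ->; rewrite -ltnNge; exact: deg.
by exists y, z; rewrite inE in xz; rewrite yT (negbTE zT).
Qed.

(** A proper coloring of the square gives the neighbors of a vertex pairwise distinct colors. *)
Lemma chi_d_le_square (G : sgraph) k : regular k G -> chi_d G <= (k + k * k).+1.
Proof.
move=> Gk.
pose e := [rel x y : G | (x != y) && (adj x y || [exists z, adj z x && adj z y])].
have [|||g gP] := @greedy_coloring G e (k + k * k).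
- move=> x y /=; rewrite eq_sym adj_sym; congr (_ && (_ || _)).
  by apply: eq_existsb => z; rewrite andbC.
- by move=> x; rewrite /= eqxx.
- move=> x; apply: leq_trans (_ : #|neighbors x :|: \bigcup_(z in neighbors x) neighbors z| <= _).
    apply/subset_leq_card/subsetP=> y; rewrite !inE => /andP[_ /orP[->//|]].
    case/existsP=> z /andP[zx zy]; apply/orP; right; apply/bigcupP.
    by exists z; rewrite inE // adj_sym.
  apply: leq_trans (leq_card_setU _ _) _; apply: leq_add; first by rewrite -[#|_|]/(degree x) Gk.
  apply: leq_trans (leq_card_bigcup _ _) _.
  rewrite (eq_bigr (fun=> k)) => [|z _]; last exact: Gk.
  by rewrite sum_nat_const -[#|_|]/(degree x) Gk.
rewrite -[X in _ <= X]card_ord; apply: (@chi_d_le_card _ _ g) => [x y xy|x].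
  by apply: gP; rewrite /= xy andbT; apply: contraTneq xy => ->; rewrite adj_irr.
case/card_gt1P=> y [z []]; rewrite !inE => xy xz yz; exists y, z; split=> //.
by apply: gP; rewrite /= yz; apply/orP; right; apply/existsP; exists x; rewrite xy.
Qed.

Lemma chi_d_degree1 (G : sgraph) : regular 1 G -> chi_d G <= chi G.
Proof.
move=> G1; have [f fP] := chi_proper G.
rewrite -[X in _ <= X]card_ord; apply: (@chi_d_le_card _ _ f) => // x.
by rewrite G1.
Qed.

(** * Numerical estimates *)

(* [m ^ m <= (m + m) ^_ m = 'C(m + m, m) * m`!]. *)
Lemma expn_le_fact m : m ^ m <= 4 ^ m * m`!.
Proof.
have C4 : 'C(m + m, m) <= 4 ^ m.
  rewrite (_ : 4 ^ m = \sum_(i < (m + m).+1) 'C(m + m, i)); last first.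
    rewrite addnn -[4]/(2 ^ 2) -expnM mul2n -[2]/(1 + 1) expnDn.
    by apply: eq_bigr => i _; rewrite !exp1n !muln1.
  have lt_m : m < (m + m).+1 by rewrite ltnS leq_addr.
  by rewrite (bigD1 (Ordinal lt_m)) //= leq_addr.
apply: leq_trans (_ : (m + m) ^_ m <= _); last by rewrite -bin_ffact leq_mul2r C4 orbT.
rewrite ffact_prod -[X in _ ^ X]card_ord -prod_nat_const.
by apply: leq_prod => i _; have := ltn_ord i; lia.
Qed.

(** By [expn_le_fact], ['C(n, m)] is at most n^m / m!, hence at most (4n/m)^m, and 4n/m is at most
    r/2. *)
Lemma bin_le_expn n m r : 0 < m -> 8 * n <= m * r -> 'C(n, m) * 2 ^ m <= r ^ m.
Proof.
move=> m_gt0 le_nr; have ffact_le : n ^_ m <= n ^ m.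
  rewrite ffact_prod -[X in _ ^ X]card_ord -prod_nat_const.
  by apply: leq_prod => i _; rewrite leq_subr.
rewrite -(leq_pmul2r (_ : 0 < m ^ m)) ?expn_gt0 ?m_gt0 // -!expnMn [r * m]mulnC.
apply: leq_trans (_ : (8 * n) ^ m <= _); last by rewrite leq_exp2r.
rewrite (_ : (8 * n) ^ m = 2 ^ m * (4 ^ m * n ^ m)); last first.
  by rewrite -!expnMn mulnA.
rewrite ['C(n, m) * _]mulnC -mulnA leq_mul2l; apply/orP; right.
apply: leq_trans (leq_mul (leqnn _) (expn_le_fact m)) _.
by rewrite mulnCA bin_ffact leq_mul2l ffact_le orbT.
Qed.

(** The first two terms of the binomial expansion of the right side suffice. *)
Lemma double_expn_pred q : 2 * q ^ q.+1 <= q.+1 ^ q.+1.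
Proof.
rewrite -[X in _ <= X ^ _]addn1 expnDn big_ord_recl big_ord_recl /= bin0 bin1.
rewrite !exp1n /= !muln1 !mul1n subn0 subn1 /=.
have := leq_pmull (q ^ q) (ltn0Sn q); rewrite !expnS; nia.
Qed.

(** * The logarithmic bound and the final constant *)

Lemma chi_d_le_chi_log (G : sgraph) k : 2 ^ 10 <= k -> regular k G ->
  chi_d G <= chi G + 80 * (trunc_log 2 k).+1.
Proof.
move=> k_large Gk; set l := (trunc_log 2 k).+1.
have k_gt0 : 0 < k by apply: leq_trans k_large; rewrite expn_gt0.
have l_ge : 10 <= trunc_log 2 k by apply: trunc_log_max.
(* For [trunc_log 2 k = 10] this follows from 880 <= 1024; each further unit doubles the power of
   two and adds only 80. *)
have lek : 80 * l <= k.
  apply: leq_trans (trunc_logP (isT : 1 < 2) k_gt0).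
  rewrite /l -(subnKC l_ge); elim: (_ - _) => [//|n IH].
  by rewrite addnS expnS; move: IH; set y := 2 ^ _; lia.
have ltk : k < 2 ^ l by apply: trunc_log_ltn.
(* [5 * l * r <= k] makes missing [T] unlikely; [8 * k <= 80 * l * r] makes
   meeting it [80 * l] times unlikely. *)
pose r := k %/ (5 * l).
have r_ge : 2 <= r by rewrite leq_divRL; lia.
have le_rk : r * (5 * l) <= k := leq_divM _ _.
have lt_kr : k < r.+1 * (5 * l) by apply: ltn_ceil; lia.
have k8 : 8 * k ^ 2 <= 2 ^ (5 * l).
  apply: leq_trans (_ : 2 ^ 3 * (2 ^ l) ^ 2 <= _).
    by apply: leq_mul => //; rewrite leq_exp2r // ltnW.
  by rewrite -expnM -expnD leq_exp2l //; lia.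
have [||T hitT] := @sparse_hitting_set G k r.-1 (80 * l) k_gt0 Gk.
- have -> : r.-1.+1 = r by lia.
  have r_pred : r = r.-1.+1 by lia.
  (* Split the exponent [k] as [r * (5 * l)] plus a remainder: each of the [5 * l] blocks of length
     [r] gains a factor 2, and together they absorb [8 * k ^ 2]. *)
  rewrite -[X in _ * _ ^ X](subnKC le_rk) -[X in _ <= _ ^ X](subnKC le_rk).
  rewrite !expnD mulnA; apply: leq_mul; last first.
    by case: (_ - _) => // n; rewrite leq_exp2r // leq_pred.
  apply: leq_trans (leq_mul k8 (leqnn _)) _.
  have e_gt0 : 0 < 5 * l by lia.
  move: (5 * l) e_gt0 => e e_gt0; rewrite !(expnM _ r) -expnMn leq_exp2r //.
  by rewrite r_pred; apply: double_expn_pred.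
- have -> : r.-1.+1 = r by lia.
  apply: leq_trans (_ : 'C(k, 80 * l) * 2 ^ (80 * l) <= _).
    rewrite mulnC leq_mul2l (leq_trans k8) ?orbT // leq_exp2l //; lia.
  (* As [r] is positive, [k < r.+1 * (5 * l) <= 10 * l * r], which gives [8 * k <= 80 * l * r]. *)
  by apply: bin_le_expn; lia.
(* The hitting bound is strict, so degree bound [80 * l - 1] applies and exactly [80 * l] new colors
   are used. *)
have l80 : 80 * l = (80 * l).-1.+1 by lia.
rewrite l80; apply: (@chi_d_le_chi_sparse _ T) => x; last by rewrite Gk -l80.
by move: (hitT x); rewrite {1}l80 ltnS.
Qed.

Local Open Scope ring_scope.

Theorem theorem2 (R : realType) :
  exists c : R, forall (k : nat) (G : sgraph),
    (0 < k)%N -> regular k G ->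
    (chi_d G)%:R <= (chi G)%:R + c * ln (k%:R : R) + 1.
Proof.
(* With [t = trunc_log 2 k] positive, [3 * (2 ^ 10) ^ 2 * t] dominates both [k + k * k + 1] for
   [k < 2 ^ 10] and [80 * (t + 1) <= 160 * t] for larger [k]; finally [t * ln 2 <= ln k]. *)
exists ((3 * (2 ^ 10) ^ 2)%N%:R / ln 2) => k G k_gt0 Gk.
have [k1|k_gt1] := leqP k 1.
  have k1' : k = 1%N by apply/eqP; rewrite eqn_leq k1.
  rewrite k1' ln1 mulr0 addr0 natr1 ler_nat.
  by apply: leqW; apply: chi_d_degree1; rewrite -k1'.
have ln2_gt0 : 0 < ln 2 :> R by rewrite ln_gt0 // ltr1n.
set t := trunc_log 2 k.
have t_gt0 : (0 < t)%N by apply: trunc_log_max.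
have ln_k : t%:R * ln 2 <= ln k%:R :> R.
  rewrite mulr_natl -lnXn ?ltr0n // ler_ln ?posrE ?exprn_gt0 ?ltr0n //.
  by rewrite -natrX ler_nat; apply: trunc_logP.
suff le_nat : (chi_d G <= chi G + 3 * (2 ^ 10) ^ 2 * t)%N.
  apply: le_trans (_ : (chi G + 3 * (2 ^ 10) ^ 2 * t)%N%:R <= _); first by rewrite ler_nat.
  rewrite natrD -addrA lerD2l natrM; apply: ler_wpDr => //.
  by rewrite -mulrA ler_wpM2l ?ler0n // mulrC ler_pdivlMr.
have b160 : (160 <= 2 ^ 10)%N by [].
have [k_small|k_large] := ltnP k (2 ^ 10).
  apply: leq_trans (chi_d_le_square Gk) _; move: (2 ^ 10)%N k_small b160 => b; nia.
apply: leq_trans (chi_d_le_chi_log k_large Gk) _; rewrite leq_add2l -/t.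
by move: (2 ^ 10)%N b160 => b b160; nia.
Qed.
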